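(* Let $(\mathbb{F}_i,\star_i)$ and $(\mathbb{F}_j,\star_j)$ be free magmas with generator sets $X_i$ and $X_j$ respectively, where $|X_i|=|X_j|$, and let $\sigma:X_i\to X_j$ be any bijection. Let $\Upsilon_{i,j}:\mathbb{F}_i\to\mathbb{F}_j$ be the universal bijection map determined by $\sigma$. Then $\Upsilon_{i,j}$ is an isomorphism of (free) magmas.
   Context: A magma $(\mathcal{M},\star)$ is a non-empty countable set $\mathcal{M}$ together with a map $\star:\mathcal{M}\times\mathcal{M}\to\mathcal{M}$ (no further conditions). A magma morphism $\theta:(\mathcal{M},\star)\to(\mathcal{N},\bullet)$ is a map with $\theta(m\star m')=\theta(m)\bullet\theta(m')$ for all $m,m'\in\mathcal{M}$; an isomorphism is a morphism having a two-sided inverse morphism. A magma $(\mathcal{M},\star)$ is free if there exist a set $\mathcal{Y}$ and a map $\iota:\mathcal{Y}\to\mathcal{M}$ such that for every magma $(\mathcal{N},\bullet)$ and every map $f:\mathcal{Y}\to\mathcal{N}$ there is a unique magma morphism $\theta:\mathcal{M}\to\mathcal{N}$ with $f=\theta\circ\iota$. The image $\iota(\mathcal{Y})\subseteq\mathcal{M}$ is called the set of generators of $\mathcal{M}$. Definition of $\Upsilon_{i,j}$ (the universal bijection determined by $\sigma$): for $x\in X_i$, $\Upsilon_{i,j}(x)=\sigma(x)$. For $u\in\mathbb{F}_i\setminus X_i$: (1) decompose $u$ into a (fully bracketed) product, with respect to $\star_i$, of generators in $X_i$ (in a free magma each element has exactly one such decomposition); (2) in this decomposition replace every occurrence of each generator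 $\varepsilon\in X_i$ by $\sigma(\varepsilon)$ and every occurrence of $\star_i$ by $\star_j$, giving an expression $w(u)$; (3) $\Upsilon_{i,j}(u)$ is the element of $\mathbb{F}_j$ obtained by evaluating all the products in $w(u)$. *)

(* Defs.v *)
From HB Require Import structures.
From mathcomp Require Import all_boot.
From mathcomp Require Import boolp classical_sets functions cardinality.

Set Implicit Arguments.
Unset Strict Implicit.
Unset Printing Implicit Defensive.

Local Open Scope classical_set_scope.
Local Open Scope group_scope.

HB.mixin Record isNonemptyCountable (T : Type) := {
  setT_nonempty : [set: T] !=set0;
  setT_countable : countable [set: T]
}.

(* A [magmaType] is an arbitrary type with a binary operation; here the carrier
   is moreover non-empty and countable. *)
#[short(type="countMagmaType")]
HB.structure Definition CountMagma := {M of isNonemptyCountable M & Magma M}.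

Definition magma_morphism (M N : magmaType) (f : M -> N) : Prop :=
  {morph f : x y / x * y}.

Definition magma_isomorphism (M N : magmaType) (f : M -> N) : Prop :=
  magma_morphism f /\
  exists g : N -> M, [/\ magma_morphism g, cancel f g & cancel g f].

Definition universal_map (Y : Type) (M : countMagmaType) (iota : Y -> M) : Prop :=
  forall (N : countMagmaType) (f : Y -> N),
    exists! theta : M -> N, magma_morphism theta /\ f = theta \o iota.

(* M is free and X is its set of generators. *)
Definition free_magma (M : countMagmaType) (X : set M) : Prop :=
  exists (Y : Type) (iota : Y -> M), universal_map iota /\ X = range iota.

(* Fully bracketed formal products of letters from A. *)
Inductive bracketing (A : Type) : Type :=
| Letter of A
| Product of bracketing A & bracketing A.

Fixpoint relabel (A B : Type) (s : A -> B) (w : bracketing A) : bracketing B :=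
  match w with
  | Letter a => Letter (s a)
  | Product w1 w2 => Product (relabel s w1) (relabel s w2)
  end.

Fixpoint evaluate (M : magmaType) (X : set M) (w : bracketing X) : M :=
  match w with
  | Letter x => val x
  | Product w1 w2 => evaluate w1 * evaluate w2
  end.

(* Two-element left-projection magma: it separates the generators of a free
   magma and shows that there is at least one. *)
Definition left_bool : Type := bool.
HB.instance Definition _ := hasMul.Build left_bool (fun x _ => x).

Fact left_bool_nonempty : [set: left_bool] !=set0. Proof. by exists true. Qed.
Fact left_bool_countable : countable [set: left_bool].
Proof. exact: (@countableP bool). Qed.
HB.instance Definition _ :=
  isNonemptyCountable.Build left_bool left_bool_nonempty left_bool_countable.

Section UniversalMap.
Variables (Y : Type) (M : countMagmaType) (iota : Y -> M).
Hypothesis univ : universal_map iota.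

Lemma universal_map_inj : injective iota.
Proof.
move=> y z eq_yz; have [theta [[_ def_theta] _]] :=
  univ (fun t => `[< t = y >] : left_bool).
have: `[< z = y >] = `[< y = y >].
  by have := congr1 (@^~ z) def_theta; have := congr1 (@^~ y) def_theta;
     rewrite /= eq_yz => -> ->.
by rewrite [RHS]asboolT // => /asboolP.
Qed.

Lemma universal_map_source_nonempty : exists y : Y, True.
Proof.
apply: contrapT => noY; have Y0 (y : Y) : False by apply: noY; exists y.
have [theta [_ theta_uniq]] := univ (fun y => match Y0 y with end : left_bool).
have eq_cst (b : left_bool) : theta = fun=> b.
  by apply: theta_uniq; split=> //; apply/funext=> y; case: (Y0 y).
have [m _] := setT_nonempty (s := M).
by have := congr1 (@^~ m) (etrans (esym (eq_cst true)) (eq_cst false)).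
Qed.

End UniversalMap.

Section Bracketings.
Variables (M : countMagmaType) (X : set M).

Definition bracketing_mul := @Product X.
HB.instance Definition _ := hasMul.Build (bracketing X) bracketing_mul.

Fixpoint bracketing_tree (g : M -> nat) (w : bracketing X) : GenTree.tree nat :=
  match w with
  | Letter x => GenTree.Leaf (g (val x))
  | Product w1 w2 =>
      GenTree.Node 0 [:: bracketing_tree g w1; bracketing_tree g w2]
  end.

Lemma bracketing_countable : countable [set: bracketing X].
Proof.
have /countable_injP[g g_inj] := setT_countable (s := M).
apply/countable_injP; exists (pickle \o bracketing_tree g) => w1 w2 _ _.
move=> /(pcan_inj pickleK).
elim: w1 w2 => [x|u1 IHu v1 IHv] [y|u2 v2] //= [].
  by move=> /g_inj -/(_ (in_setT _) (in_setT _)) /val_inj ->.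
by move=> /IHu -> /IHv ->.
Qed.

Lemma evaluate_surj :
  free_magma X -> forall u : M, exists w : bracketing X, evaluate w = u.
Proof.
move=> [Y [iota [univ defX]]].
pose P := [set u : M | exists w : bracketing X, evaluate w = u].
have P_iota y : P (iota y).
  have Xy : iota y \in X by rewrite defX inE; exists y.
  by exists (Letter (exist (fun v => v \in X) _ Xy)).
have P_mul (u v : P) : val u * val v \in P.
  have [[w1 Ew1] [w2 Ew2]] := (set_valP u, set_valP v).
  by rewrite inE; exists (Product w1 w2); rewrite /= Ew1 Ew2.
pose S : Type := {u : M | u \in P}.
have S_nonempty : [set: S] !=set0.
  have [y _] := universal_map_source_nonempty univ.
  by exists (exist (fun v => v \in P) (iota y) (mem_set (P_iota y))).
have S_countable : countable [set: S].
  have /countable_injP[g g_inj] := setT_countable (s := M).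
  apply/countable_injP; exists (g \o val) => a b _ _ /=.
  by move=> /g_inj -/(_ (in_setT _) (in_setT _)) /val_inj.
pose mS := hasMul.Build S (fun u v => exist (fun v => v \in P) (val u * val v) (P_mul u v)).
pose cS := isNonemptyCountable.Build S S_nonempty S_countable.
pose SM : countMagmaType := HB.pack S mS cS.
pose iotaS y : SM := exist (fun v => v \in P) (iota y) (mem_set (P_iota y)).
have [theta [[theta_mul def_iotaS] _]] := univ SM iotaS.
have [id' [_ id_uniq]] := univ M iota.
have id'E : id' = id by apply: id_uniq.
have valE : id' = (fun u => sval (theta u)).
  apply: id_uniq; split; first by move=> u v /=; rewrite theta_mul.
  by apply/funext=> y; rewrite /= -[theta _]/((theta \o iota) y) -def_iotaS.
move=> u; suff: P u by [].
rewrite -[u]/(id u) -id'E valE; exact: set_valP (theta u : P).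
Qed.

Lemma evaluate_inj : free_magma X -> injective (@evaluate M X).
Proof.
move=> [Y [iota [univ defX]]].
have gen y : iota y \in X by rewrite defX inE; exists y.
have w_nonempty : [set: bracketing X] !=set0.
  have [y _] := universal_map_source_nonempty univ.
  by exists (Letter (exist (fun v => v \in X) _ (gen y))).
pose cW := isNonemptyCountable.Build (bracketing X) w_nonempty
  bracketing_countable.
pose W : countMagmaType := HB.pack (bracketing X) cW.
have [theta [[theta_mul def_theta] _]] :=
  univ W (fun y => Letter (exist (fun v => v \in X) _ (gen y))).
apply: (can_inj (g := theta)); elim=> [x|w1 IH1 w2 IH2] /=.
  have [y _ def_x] : range iota (val x) by rewrite -defX; exact: set_valP.
  have <- : exist (fun v => v \in X) _ (gen y) = x by exact: val_inj.
  by rewrite -[LHS]/((theta \o iota) y) -def_theta.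
by rewrite theta_mul IH1 IH2.
Qed.

Lemma unique_decomposition :
  free_magma X -> forall u : M, exists! w : bracketing X, evaluate w = u.
Proof.
move=> freeX u; have [w def_u] := evaluate_surj freeX u.
by exists w; split=> // w' def_w'; apply: evaluate_inj; rewrite // def_u.
Qed.

End Bracketings.

Definition decompose (M : countMagmaType) (X : set M) (freeX : free_magma X)
  (u : M) : bracketing X := sval (cid (unique_decomposition freeX u)).

(* [insub u] is [Some x], with x the element u of the subtype X, when u is a
   generator, and [None] otherwise. *)
Definition upsilon (M N : countMagmaType) (X : set M) (Z : set N)
    (freeX : free_magma X) (sigma : X -> Z) (u : M) : N :=
  match (insub u : option X) with
  | Some x => val (sigma x)
  | None => evaluate (relabel sigma (decompose freeX u))
  end.

(* Main.v *)
(* Evaluation is a bijective morphism from the bracketings of the generators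
   onto a free magma, and it conjugates upsilon to relabelling by sigma.
   Relabelling by the inverse of sigma therefore gives the inverse morphism. *)
Require Import Defs.
From mathcomp Require Import all_boot.
From mathcomp Require Import boolp classical_sets functions cardinality.

Local Open Scope classical_set_scope.
Local Open Scope card_scope.

Lemma relabelK (A B : Type) (s : A -> B) (t : B -> A) :
  cancel s t -> cancel (relabel s) (relabel t).
Proof. by move=> sK; elim=> [a|w1 IH1 w2 IH2] /=; rewrite ?sK ?IH1 ?IH2. Qed.

(** The chosen decomposition of [evaluate w] has the same value as [w], and evaluation is
    injective. *)
Lemma evaluateK (M : countMagmaType) (X : set M) (freeX : free_magma X) :
  cancel (@evaluate M X) (decompose freeX).
Proof.
by move=> w; apply: (evaluate_inj freeX); rewrite /decompose; case: cid => v [].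
Qed.

Lemma upsilon_evaluate (M N : countMagmaType) (X : set M) (Z : set N)
    (freeX : free_magma X) (sigma : X -> Z) (w : bracketing X) :
  upsilon freeX sigma (evaluate w) = evaluate (relabel sigma w).
Proof.
rewrite /upsilon; case: insubP => [x _ def_x|_]; last by rewrite evaluateK.
(* A bracketing whose value is a generator is that single letter, so the two branches of [upsilon]
   agree. *)
by have -> : w = Letter x by apply: (evaluate_inj freeX); rewrite -def_x.
Qed.

Lemma upsilon_morphism (M N : countMagmaType) (X : set M) (Z : set N)
    (freeX : free_magma X) (sigma : X -> Z) :
  magma_morphism (upsilon freeX sigma).
Proof.
move=> u v; have [w1 <-] := evaluate_surj freeX u.
have [w2 <-] := evaluate_surj freeX v.
(* By conversion, the product of two values is the value of the [Product]. *)
by rewrite -[LHS]/(upsilon _ _ (evaluate (Product w1 w2))) !upsilon_evaluate.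
Qed.

(** Stated for a one-sided inverse, so that exchanging [sigma] and [tau] gives both cancellations of
    the isomorphism. *)
Lemma upsilonK (M N : countMagmaType) (X : set M) (Z : set N)
    (freeX : free_magma X) (freeZ : free_magma Z)
    (sigma : X -> Z) (tau : Z -> X) :
  cancel sigma tau -> cancel (upsilon freeX sigma) (upsilon freeZ tau).
Proof.
move=> sigmaK u; have [w <-] := evaluate_surj freeX u.
by rewrite !upsilon_evaluate relabelK.
Qed.

Theorem corollary1 (Fi Fj : countMagmaType) (Xi : set Fi) (Xj : set Fj)
    (free_i : free_magma Xi) (free_j : free_magma Xj) (card_ij : Xi #= Xj)
    (sigma : Xi -> Xj) (sigma_bij : bijective sigma) :
  magma_isomorphism (upsilon free_i sigma).
Proof.
case: sigma_bij => tau sigmaK tauK; split; first exact: upsilon_morphism.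
exists (upsilon free_j tau).
by split; [exact: upsilon_morphism | exact: upsilonK | exact: upsilonK].
Qed.
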